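(* Consider the problem $\min_{x\in\mathbb{R}^d}f(x)$, $f(x)=\frac1s\|Ax-b\|^2$, with $A\in\mathbb{R}^{s\times d}$, $b\in\mathbb{R}^s$, and suppose that all eigenvalues of $A^TA$ lie in $[\mu,L]$ with $0<\mu\le L$. In the vertical regime, the efficient Lipschitz constant for the PermK compressor is less than $$\widetilde L_{Perm}=2L\,\frac{s\sum_{j=1}^sL_j^2}{\mu^2}.$$
   Context: $A_j$ is the $j$-th row of $A$ (a sample, viewed as a vector in $\mathbb{R}^d$), and $L_j$ is the smoothness (Lipschitz gradient) constant of the $j$-th sample's loss $f_j(x)=(A_j^Tx-b_j)^2$. The $d$ coordinates are partitioned into $n$ blocks, one per worker; $A_{ji}$ and $x_i$ denote the subvectors of $A_j$ and $x$ on the block of worker $i$. PermK in the vertical regime: at each iteration every worker gets its own random set of samples, the sets of different workers being disjoint, each sample being assigned to worker $i$ with probability $\frac1n$; let $I_{ji}\in\{0,1\}$ indicate that sample $j$ is assigned to worker $i$, so $\mathbb{E}I_{ji}^2=\frac1n$ and $I_{ji}I_{jt}=0$ for $i\ne t$. Worker $i$ transmits $\langle A_{ji},x^k_i-w^k_i\rangle$ only for its samples (scaled by $n$ for unbiasedness), and the gradient estimator is $g^k=\frac{2n}{s}\sum_{j=1}^sA_j\sum_{i=1}^n\langle A_{ji},x^k_i-w^k_i\rangle I_{ji}+\nabla f(w^k)$. Here the iterates are those of the Katyusha-type scheme with real parameters $\theta_1,\theta_2,\eta,\sigma$, a constant $\Lambda>0$ and $p\in(0,1]$: $y^0=w^0=z^0$;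 $x^k=\theta_1z^k+\theta_2w^k+(1-\theta_1-\theta_2)y^k$; $z^{k+1}=\frac1{1+\eta\sigma}(\eta\sigma x^k+z^k-\frac\eta\Lambda g^k)$; $y^{k+1}=x^k+\theta_1(z^{k+1}-z^k)$; $w^{k+1}=y^k$ with probability $p$, $w^{k+1}=w^k$ with probability $1-p$. Efficient Lipschitz constant: the smallest constant $\widetilde L$ such that $\mathbb{E}\|g^k-\nabla f(x^k)\|^2\le2\widetilde L\bigl(f(w^k)-f(x^k)-\langle\nabla f(x^k),w^k-x^k\rangle\bigr)$, where the expectation is over the randomness of the assignment given $x^k,w^k$. *)

(* Defs.v *)
From HB Require Import structures.
From mathcomp Require Import all_boot all_order all_algebra.
From mathcomp Require Import all_classical all_reals all_analysis.
Import Order.TTheory GRing.Theory Num.Theory numFieldNormedType.Exports.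

Set Implicit Arguments.
Unset Strict Implicit.
Unset Printing Implicit Defensive.

Local Open Scope ring_scope.

Section Euclidean.
Variables (R : realType) (d : nat).
Implicit Types (u v x : 'cV[R]_d) (F : 'cV[R]_d -> R).

Definition dot u v : R := \sum_c u c 0 * v c 0.

Definition sqnorm u : R := dot u u.

(* The norm [`|u|] of the library on matrices is the sup norm. *)
Definition enorm u : R := Num.sqrt (sqnorm u).

Definition gradient F x : 'cV[R]_d := \col_c 'D_(delta_mx c 0) F x.

Definition is_least (S : set R) (m : R) : Prop := S m /\ lbound S m.

Definition smoothness_constant F (ell : R) : Prop :=
  is_least
    [set l | forall x y,
       enorm (gradient F x - gradient F y) <= l * enorm (x - y)]%classic ell.

End Euclidean.

Section FiniteProbability.
Variables (R : realType) (T : finType).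
Implicit Types (P : T -> R) (E : pred T) (X : T -> R).

Definition is_pmf P : Prop := (forall t, 0 <= P t) /\ \sum_t P t = 1.

Definition Pr P E : R := \sum_(t | E t) P t.

Definition cond_expectation P E X : R := (\sum_(t | E t) P t * X t) / Pr P E.

End FiniteProbability.

Section LeastSquares.
Variables (R : realType) (s d : nat) (A : 'M[R]_(s, d)) (b : 'cV[R]_s).

Definition loss (x : 'cV[R]_d) : R := s%:R^-1 * sqnorm (A *m x - b).

Definition sample (j : 'I_s) : 'cV[R]_d := (row j A)^T.

Definition sample_loss (j : 'I_s) (x : 'cV[R]_d) : R :=
  (dot (sample j) x - b j 0) ^+ 2.

End LeastSquares.

(* A partition of the [d] coordinates into [n] blocks is given by the map
   sending a coordinate to its worker; no block is empty. *)
Definition is_block_partition (d n : nat) (blk : 'I_d -> 'I_n) : Prop :=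
  forall i, exists c, blk c = i.

Section PermK.
Variables (R : realType) (s d n : nat).
Variables (A : 'M[R]_(s, d)) (b : 'cV[R]_s) (blk : 'I_d -> 'I_n).

(* [a i] is the set of samples that worker [i] receives. *)
Definition assignment := {ffun 'I_n -> {set 'I_s}}.

(* The joint law of the assignment of different samples is only constrained by
   the disjointness of the sets of different workers. *)
Definition permk_law (q : assignment -> R) : Prop :=
  [/\ is_pmf q,
      forall (a : assignment) (i t : 'I_n),
        0 < q a -> i != t -> [disjoint a i & a t]
    & forall (j : 'I_s) (i : 'I_n),
        Pr q (fun a : assignment => j \in a i) = n%:R^-1].

Definition indicator (a : assignment) (j : 'I_s) (i : 'I_n) : R :=
  (j \in a i)%:R.

Definition block_dot (i : 'I_n) (u v : 'cV[R]_d) : R :=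
  \sum_(c | blk c == i) u c 0 * v c 0.

Definition estimator (a : assignment) (x w : 'cV[R]_d) : 'cV[R]_d :=
  (2 * n%:R / s%:R) *:
    (\sum_j (\sum_i block_dot i (sample A j) (x - w) * indicator a j i)
              *: sample A j)
  + gradient (loss A b) w.

Record parameters := MkPrm {
  theta1 : R;
  theta2 : R;
  eta : R;
  sigma : R;
  Lambda : R }.

Record state := State {
  y_of : 'cV[R]_d;
  z_of : 'cV[R]_d;
  w_of : 'cV[R]_d }.

Definition x_of (prm : parameters) (st : state) : 'cV[R]_d :=
  theta1 prm *: z_of st + theta2 prm *: w_of st
  + (1 - theta1 prm - theta2 prm) *: y_of st.

(* The random choices of one iteration: the assignment, and whether [w] is
   replaced by [y]. *)
Definition round := (assignment * bool)%type.

Definition step (prm : parameters) (st : state) (r : round) : state :=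
  let x := x_of prm st in
  let g := estimator r.1 x (w_of st) in
  let z' := (1 + eta prm * sigma prm)^-1 *:
              ((eta prm * sigma prm) *: x + z_of st
               - (eta prm / Lambda prm) *: g) in
  State (x + theta1 prm *: (z' - z_of st)) z'
        (if r.2 then y_of st else w_of st).

Definition run (prm : parameters) (x0 : 'cV[R]_d) (h : seq round) : state :=
  foldl (step prm) (State x0 x0 x0) h.

(* The assignments and the coin flips are drawn independently. *)
Definition history_law (q : assignment -> R) (p : R) (h : seq round) : R :=
  \prod_(r <- h) (q r.1 * (if r.2 then p else 1 - p)).

(* Joint law of the [k] iterations that determine [x^k] and [w^k], and of the
   assignment that is used to form [g^k]. *)
Definition iteration_law (q : assignment -> R) (p : R) (k : nat)
    (t : k.-tuple round * assignment) : R :=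
  history_law q p t.1 * q t.2.

(* The event [x^k = x] and [w^k = w]. *)
Definition at_point (prm : parameters) (x0 : 'cV[R]_d) (k : nat)
    (x w : 'cV[R]_d) : pred (k.-tuple round * assignment) :=
  fun t => (x_of prm (run prm x0 t.1) == x) && (w_of (run prm x0 t.1) == w).

Definition sq_error (prm : parameters) (x0 : 'cV[R]_d) (k : nat)
    (t : k.-tuple round * assignment) : R :=
  let xk := x_of prm (run prm x0 t.1) in
  let wk := w_of (run prm x0 t.1) in
  sqnorm (estimator t.2 xk wk - gradient (loss A b) xk).

(* The requirement [0 <= l] only matters when all the iterates satisfy
   [x^k = w^k]: both sides of the inequality then vanish, and it would hold for
   every real [l]. *)
Definition is_efficient_lipschitz (q : assignment -> R) (p : R)
    (prm : parameters) (x0 : 'cV[R]_d) : R -> Prop :=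
  let f := loss A b in
  is_least
    [set l | 0 <= l /\
       forall (k : nat) (x w : 'cV[R]_d),
         0 < Pr (@iteration_law q p k) (at_point prm x0 x w) ->
         cond_expectation (@iteration_law q p k) (at_point prm x0 x w)
           (@sq_error prm x0 k)
         <= 2 * l * (f w - f x - dot (gradient f x) (w - x))]%classic.

End PermK.

(* Main.v *)
Require Import Defs.
From HB Require Import structures.
From mathcomp Require Import all_boot all_order all_algebra.
From mathcomp Require Import all_classical all_reals all_analysis.
From mathcomp Require Import ring lra.
Import Order.TTheory GRing.Theory Num.Theory numFieldNormedType.Exports.

(** Write [u = x - w], let [c_j] be the sum transmitted for sample [j], and let
    [F] be the sum of the squared norms of the samples. The gradient of [f] is
    [(2/s) A^T (A x - b)], so the error of the estimator is
    [(2/s) A^T (n c - A u)], while the Bregman divergence of [f] is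
    [|A u|^2 / s]: the problem is to compare the variance of [n c] with
    [|A u|^2].

    - The eigenvalues of [A^T A] bound its quadratic form
      ([sqnorm_mulmx_ge_eigenvalue], [sqnorm_mulmx_le_eigenvalue]):
      [mu |u|^2 <= |A u|^2 <= L |u|^2], and [A^T] has the same upper bound
      ([sqnorm_trmx_mulmx_le]). Both rest on [psd_ge_eigenvalue], the lower
      bound of a positive semidefinite form by the eigenvalues.
    - A sample goes to at most one worker, so in [c_j ^+ 2] the cross terms
      vanish, and [n c_j] has second moment [n] times the sum over the blocks of
      [<A_ji, u_i>^2] ([permk_variance]), which is at most [n |A_j|^2 |u|^2].
      Otherwise only the marginal law of each sample enters, as the squared norm
      of [n c - A u] is a sum over the samples.
    - Hence [E |g - grad f(x)|^2 <= (4 L / s^2) n F |u|^2]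
      ([permk_error_le]), and [l0 = 2 L n F / (s mu)] satisfies the inequality
      that defines the efficient Lipschitz constant. The constraints on this
      constant are closed half-lines, so it exists and is at most [l0]
      ([least_coefficient]).

    The number [n] of workers is then absorbed: the blocks are nonempty, so
    [n <= d] and [n mu <= d mu <= tr (A^T A) = F] ([sqfrobenius_ge]). As
    [L_j >= 2 |A_j|^2] ([smoothness_sample_loss_ge]), Cauchy-Schwarz gives
    [4 F^2 <= s * sum of the L_j^2], so that the claimed bound is at least
    [8 L F^2 / mu^2 >= 8 L n F / mu > l0]. *)

Set Implicit Arguments.
Unset Strict Implicit.
Unset Printing Implicit Defensive.

Local Open Scope classical_set_scope.
Local Open Scope ring_scope.

(** * The Euclidean inner product *)

Section Dot.
Context {R : realType} {d : nat}.
Implicit Types (u v w : 'cV[R]_d) (k : R).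

Lemma dotE u v : dot u v = (u^T *m v) 0 0.
Proof. by rewrite mxE; apply: eq_bigr => c _; rewrite mxE. Qed.

Lemma dotC u v : dot u v = dot v u.
Proof. by apply: eq_bigr => c _; rewrite mulrC. Qed.

Lemma dotDl u v w : dot (u + v) w = dot u w + dot v w.
Proof. by rewrite !dotE linearD mulmxDl mxE. Qed.

Lemma dotDr u v w : dot u (v + w) = dot u v + dot u w.
Proof. by rewrite !dotE mulmxDr mxE. Qed.

Lemma dotZl k u v : dot (k *: u) v = k * dot u v.
Proof. by rewrite !dotE linearZ -scalemxAl mxE. Qed.

Lemma dotZr k u v : dot u (k *: v) = k * dot u v.
Proof. by rewrite dotC dotZl dotC. Qed.

Lemma dotNr u v : dot u (- v) = - dot u v.
Proof. by rewrite -scaleN1r dotZr mulN1r. Qed.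

Lemma dot_delta u c : dot u (delta_mx c 0) = u c 0.
Proof.
rewrite /dot (bigD1 c) //= mxE !eqxx mulr1 big1 ?addr0 // => e /negPf ec.
by rewrite mxE ec mulr0.
Qed.

Lemma sqnorm_ge0 u : 0 <= sqnorm u.
Proof. by apply: sumr_ge0 => c _; rewrite -expr2 sqr_ge0. Qed.

Lemma sqnorm_eq0 u : (sqnorm u == 0) = (u == 0).
Proof.
apply/eqP/eqP => [/psumr_eq0P u0|->]; last first.
  by rewrite /sqnorm dotE mulmx0 mxE.
apply/colP => c; rewrite mxE; apply/eqP.
by rewrite -[_ == 0]orbb -mulf_eq0 u0 // => e _; rewrite -expr2 sqr_ge0.
Qed.

Lemma sqnorm0 : sqnorm (0 : 'cV[R]_d) = 0.
Proof. by apply/eqP; rewrite sqnorm_eq0. Qed.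

Lemma sqnormZ k u : sqnorm (k *: u) = k ^+ 2 * sqnorm u.
Proof. by rewrite /sqnorm dotZl dotZr mulrA expr2. Qed.

Lemma sqnorm_line (h : R) u v :
  sqnorm (h *: u + v) = sqnorm v + h * (2 * dot v u) + h ^+ 2 * sqnorm u.
Proof.
rewrite /sqnorm !(dotDl, dotDr, dotZl, dotZr) (dotC u v); ring.
Qed.

End Dot.

Lemma dot_mulmx {R : realType} {m d : nat} (B : 'M[R]_(m, d)) u v :
  dot (B *m u) v = dot u (B^T *m v).
Proof. by rewrite !dotE trmx_mul mulmxA. Qed.

Lemma ge0_quadratic_discriminant {R : realType} (a b c : R) : 0 <= c ->
  (forall t, 0 <= a + t * (2 * b) + t ^+ 2 * c) -> b ^+ 2 <= a * c.
Proof.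
rewrite le_eqVlt => /predU1P[<-|c0] pos.
  rewrite mulr0; have [->|b0] := eqVneq b 0; first by rewrite expr0n.
  have := pos (- (a + 1) / (2 * b)).
  have -> : - (a + 1) / (2 * b) * (2 * b) = - (a + 1) by field.
  by lra.
have := pos (- b / c).
have -> : a + - b / c * (2 * b) + (- b / c) ^+ 2 * c = a - b ^+ 2 / c.
  by field; lra.
by rewrite subr_ge0 ler_pdivrMr.
Qed.

(** * Positive semidefinite forms and eigenvalues *)

Definition psd {R : realType} {d : nat} (M : 'M[R]_d) : Prop :=
  M^T = M /\ forall u : 'cV[R]_d, 0 <= dot u (M *m u).

(** The form is nonnegative along the line through [u] directed by [v], so the
    discriminant of its restriction to that line is nonpositive. *)
Lemma psd_CauchySchwarz {R : realType} {d : nat} (M : 'M[R]_d) u v : psd M ->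
  dot u (M *m v) ^+ 2 <= dot u (M *m u) * dot v (M *m v).
Proof.
case=> symM posM; apply: ge0_quadratic_discriminant => // t.
have := posM (t *: v + u); congr (0 <= _).
rewrite mulmxDr -scalemxAr !(dotDl, dotDr, dotZl, dotZr).
have -> : dot v (M *m u) = dot u (M *m v) by rewrite dotC dot_mulmx symM.
ring.
Qed.

Lemma psd1 {R : realType} {d : nat} : psd (1%:M : 'M[R]_d).
Proof. by split=> [|u]; rewrite ?trmx1 // mul1mx sqnorm_ge0. Qed.

Lemma dot_CauchySchwarz {R : realType} {d : nat} (u v : 'cV[R]_d) :
  dot u v ^+ 2 <= sqnorm u * sqnorm v.
Proof. by have := psd_CauchySchwarz u v psd1; rewrite !mul1mx. Qed.

Definition sqfrobenius {R : realType} {m d : nat} (B : 'M[R]_(m, d)) : R :=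
  \sum_j sqnorm (sample B j).

Lemma mulmx_sample {R : realType} {m d : nat} (B : 'M[R]_(m, d)) u j :
  (B *m u) j 0 = dot (sample B j) u.
Proof. by rewrite mxE; apply: eq_bigr => c _; rewrite !mxE. Qed.

Lemma sqfrobenius_ge0 {R : realType} {m d : nat} (B : 'M[R]_(m, d)) :
  0 <= sqfrobenius B.
Proof. by apply: sumr_ge0 => j _; apply: sqnorm_ge0. Qed.

Lemma sqnorm_mulmx_le {R : realType} {m d : nat} (B : 'M[R]_(m, d)) u :
  sqnorm (B *m u) <= sqfrobenius B * sqnorm u.
Proof.
rewrite mulr_suml; apply: ler_sum => j _.
by rewrite -expr2 mulmx_sample dot_CauchySchwarz.
Qed.

(** The inverse of [N] bounds [u] by [N *m u], and Cauchy-Schwarz for the form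
    of [N] bounds [N *m u] by the value of the form at [u]. *)
Lemma psd_unitmx_coercive {R : realType} {d : nat} (N : 'M[R]_d) :
  psd N -> N \in unitmx ->
  exists2 e : R, 0 < e & forall u, e * sqnorm u <= dot u (N *m u).
Proof.
move=> psdN Nunit; have [_ posN] := psdN.
set K := sqfrobenius (invmx N); set F := sqfrobenius N.
have K0 : 0 <= K by exact: sqfrobenius_ge0.
have F0 : 0 <= F by exact: sqfrobenius_ge0.
exists ((K + 1) * (F + 1))^-1; first by rewrite invr_gt0 mulr_gt0 // ltr_wpDl.
move=> u; rewrite mulrC ler_pdivrMr ?mulr_gt0 ?ltr_wpDl //.
set w := N *m u; set Q := dot u w.
have Q0 : 0 <= Q by exact: posN.
have uw : sqnorm u <= K * sqnorm w.
  by rewrite -[u in sqnorm u](mulKmx Nunit) sqnorm_mulmx_le.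
(* Expanding [0 <= |w - N w|^2] gives [2 <w, N w> <= |w|^2 + |N w|^2]. *)
have wNw : dot w (N *m w) <= (F + 1) * sqnorm w.
  have := sqnorm_ge0 (-1 *: (N *m w) + w); rewrite sqnorm_line.
  have := sqnorm_mulmx_le N w; rewrite -/F.
  have := posN w; lra.
have wQ : sqnorm w <= (F + 1) * Q.
  have [w0|w0] := eqVneq (sqnorm w) 0; first by rewrite w0 mulr_ge0 // addr_ge0.
  have w_gt0 : 0 < sqnorm w by rewrite lt_def w0 sqnorm_ge0.
  have := psd_CauchySchwarz w u psdN; rewrite -/w -/Q -/(sqnorm w) => cs.
  rewrite -(ler_pM2r w_gt0) -expr2 (le_trans cs) //.
  by rewrite mulrAC ler_wpM2r.
have := sqnorm_ge0 w; nra.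
Qed.

(** No diagonalization is involved: let [t] be the largest real such
    that [M - t] is positive semidefinite. If [M - t] were invertible, it would
    be coercive, and [t] could be increased; so [t] is an eigenvalue, whence
    [m <= t]. *)
Lemma psd_ge_eigenvalue {R : realType} {d : nat} (M : 'M[R]_d) (m : R) :
  psd M -> (forall a, eigenvalue M a -> m <= a) ->
  forall u, m * sqnorm u <= dot u (M *m u).
Proof.
move=> [symM posM] eig v.
have [->|v0] := eqVneq v 0; first by rewrite sqnorm0 mulr0 posM.
have v_gt0 : 0 < sqnorm v by rewrite lt_def sqnorm_eq0 v0 sqnorm_ge0.
pose S := [set t : R | forall u, t * sqnorm u <= dot u (M *m u)]%classic.
have S0 : S 0 by move=> u; rewrite mul0r.
have supS : has_sup S.
  split; first by exists 0.
  exists (dot v (M *m v) / sqnorm v) => t /(_ v).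
  by rewrite ler_pdivlMr.
have tS : S (sup S).
  move=> u; have [u0|u0] := eqVneq (sqnorm u) 0; first by rewrite u0 mulr0.
  have u_gt0 : 0 < sqnorm u by rewrite lt_def u0 sqnorm_ge0.
  rewrite -ler_pdivlMr //; apply: ge_sup; first by exists 0.
  (* [t] in [S] means that [t] is at most the Rayleigh quotient of [u]. *)
  by move=> t /(_ u); rewrite ler_pdivlMr.
pose N := M - (sup S)%:M.
have NE u : dot u (N *m u) = dot u (M *m u) - sup S * sqnorm u.
  by rewrite mulmxBl mul_scalar_mx dotDr dotNr dotZr.
have psdN : psd N.
  split=> [|u]; first by rewrite linearB /= tr_scalar_mx symM.
  by rewrite NE subr_ge0 tS.
suff mS : m <= sup S by apply: le_trans (tS v); rewrite ler_wpM2r // ltW.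
apply: eig; rewrite /eigenvalue /eigenspace -/N kermx_eq0 row_free_unit.
apply/negP => /(psd_unitmx_coercive psdN)[e e0 coer].
suff /(ub_le_sup supS.2) : S (sup S + e) by rewrite gerDl leNgt e0.
by move=> u; have := coer u; rewrite NE mulrDl; lra.
Qed.

Lemma gram_psd {R : realType} {m d : nat} (B : 'M[R]_(m, d)) : psd (B^T *m B).
Proof.
split=> [|u]; first by rewrite trmx_mul trmxK.
by rewrite -mulmxA -dot_mulmx sqnorm_ge0.
Qed.

Lemma sqnorm_mulmx_ge_eigenvalue {R : realType} {s d : nat} (A : 'M[R]_(s, d))
    (mu : R) :
  (forall a, eigenvalue (A^T *m A) a -> mu <= a) ->
  forall u, mu * sqnorm u <= sqnorm (A *m u).
Proof.
move=> eig u; rewrite [leRHS]dot_mulmx mulmxA.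
exact: psd_ge_eigenvalue (gram_psd A) eig u.
Qed.

(** Here [psd_ge_eigenvalue] is applied to [F - A^T *m A], where [F] is any
    upper bound of the form of [A^T *m A], such as the squared Frobenius norm:
    the eigenvalues of the difference are [F - a] for [a] those of [A^T *m A]. *)
Lemma sqnorm_mulmx_le_eigenvalue {R : realType} {s d : nat} (A : 'M[R]_(s, d))
    (L : R) :
  (forall a, eigenvalue (A^T *m A) a -> a <= L) ->
  forall u, sqnorm (A *m u) <= L * sqnorm u.
Proof.
move=> eig u; pose F := sqfrobenius A.
pose N : 'M[R]_d := F%:M - A^T *m A.
have NE w : dot w (N *m w) = F * sqnorm w - sqnorm (A *m w).
  by rewrite mulmxBl mul_scalar_mx dotDr dotNr dotZr -mulmxA -dot_mulmx.
have psdN : psd N.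
  split=> [|w]; first by rewrite linearB /= tr_scalar_mx trmx_mul trmxK.
  by rewrite NE subr_ge0 sqnorm_mulmx_le.
have eigN a : eigenvalue N a -> F - L <= a.
  case/eigenvalueP => v vN v0; rewrite lerBlDl -lerBlDr; apply: eig.
  apply/eigenvalueP; exists v => //.
  have -> : A^T *m A = F%:M - N by rewrite opprB addrC subrK.
  by rewrite mulmxBr mul_mx_scalar vN scalerBl.
by have := psd_ge_eigenvalue psdN eigN u; rewrite NE mulrBl; lra.
Qed.

(** With [w = A^T *m v], Cauchy-Schwarz gives
    [|w|^4 = <A w, v>^2 <= L |w|^2 |v|^2]; this spares a comparison of the
    spectra of [A^T *m A] and [A *m A^T]. *)
Lemma sqnorm_trmx_mulmx_le {R : realType} {s d : nat} (A : 'M[R]_(s, d))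
    (L : R) : 0 <= L ->
  (forall u, sqnorm (A *m u) <= L * sqnorm u) ->
  forall v, sqnorm (A^T *m v) <= L * sqnorm v.
Proof.
move=> L0 AL v; set w := A^T *m v.
have [w0|w0] := eqVneq (sqnorm w) 0; first by rewrite w0 mulr_ge0 ?sqnorm_ge0.
have w_gt0 : 0 < sqnorm w by rewrite lt_def w0 sqnorm_ge0.
rewrite -(ler_pM2r w_gt0) -expr2.
have wE : dot (A *m w) v = sqnorm w by rewrite dot_mulmx.
rewrite -{1}wE; apply: le_trans (dot_CauchySchwarz _ _) _.
by rewrite mulrAC ler_wpM2r ?sqnorm_ge0 ?AL.
Qed.

Lemma sum_sqr_le {R : realType} {s : nat} (f : 'I_s -> R) :
  (\sum_j f j) ^+ 2 <= s%:R * \sum_j f j ^+ 2.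
Proof.
have := dot_CauchySchwarz (const_mx 1) (\col_j f j).
rewrite /sqnorm /dot; under eq_bigr do rewrite !mxE mul1r.
under [X in _ <= X * _]eq_bigr do rewrite !mxE mul1r.
under [X in _ <= _ * X]eq_bigr do rewrite !mxE -expr2.
by rewrite sumr_const card_ord.
Qed.

Lemma sqfrobenius_col {R : realType} {s d : nat} (A : 'M[R]_(s, d)) :
  sqfrobenius A = \sum_c sqnorm (A *m delta_mx c 0).
Proof.
rewrite exchange_big; apply: eq_bigr => c _; apply: eq_bigr => j _.
by rewrite mulmx_sample dot_delta.
Qed.

(** The squared Frobenius norm is the trace of the Gram matrix, that is, the sum
    of its quadratic form over the [d] basis vectors. *)
Lemma sqfrobenius_ge {R : realType} {s d : nat} (A : 'M[R]_(s, d)) (mu : R) :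
  (forall u, mu * sqnorm u <= sqnorm (A *m u)) -> d%:R * mu <= sqfrobenius A.
Proof.
move=> Amu; rewrite sqfrobenius_col mulr_natl -[X in _ *+ X](card_ord d).
rewrite -sumr_const; apply: ler_sum => c _; apply: le_trans (Amu _).
by rewrite /sqnorm dot_delta mxE !eqxx mulr1.
Qed.

(** * Gradients of quadratic functions *)

(** [gradient] is made of directional derivatives, so the expansion of [F] along
    lines through [x] determines it. *)
Lemma gradient_quadratic {R : realType} {d : nat} (F : 'cV[R]_d -> R)
    (C : 'cV[R]_d -> R) (x G : 'cV[R]_d) :
  (forall (h : R) (v : 'cV[R]_d),
     F (h *: v + x) = F x + h * dot G v + h ^+ 2 * C v) ->
  gradient F x = G.
Proof.
move=> FE; apply/colP => c; rewrite mxE -[RHS]dot_delta.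
set v := delta_mx c 0.
rewrite /derive; apply: cvg_lim => //.
have affine_cvg : dot G v + h * C v @[h --> 0^'] --> dot G v.
  rewrite -[X in _ --> X]addr0 -[X in _ --> _ + X](mul0r (C v)).
  apply: cvgD; first exact: cvg_cst.
  apply: cvgM; last exact: cvg_cst.
  exact: nbhs_dnbhs.
apply: cvg_trans affine_cvg; apply: near_eq_cvg; near=> h.
have h0 : h != 0 by near: h; exact: nbhs_dnbhs_neq.
rewrite /= FE /GRing.scale /=; field.
Unshelve. all: by end_near.
Qed.

Lemma gradient_loss {R : realType} {s d : nat} (A : 'M[R]_(s, d)) b x :
  gradient (loss A b) x = (2 / s%:R) *: (A^T *m (A *m x - b)).
Proof.
apply: (@gradient_quadratic _ _ _ (fun v => s%:R^-1 * sqnorm (A *m v))) => h v.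
rewrite /loss (mulmxDr A) -scalemxAr -addrA sqnorm_line dotZl.
rewrite (dot_mulmx A^T) trmxK; ring.
Qed.

Lemma gradient_sample_loss {R : realType} {s d : nat} (A : 'M[R]_(s, d)) b j x :
  gradient (sample_loss A b j) x =
  (2 * (dot (sample A j) x - b j 0)) *: sample A j.
Proof.
apply: (@gradient_quadratic _ _ _ (fun v => dot (sample A j) v ^+ 2)) => h v.
rewrite /sample_loss dotDr dotZr dotZl; ring.
Qed.

Lemma loss_Bregman {R : realType} {s d : nat} (A : 'M[R]_(s, d)) b x w :
  loss A b w - loss A b x - dot (gradient (loss A b) x) (w - x)
  = s%:R^-1 * sqnorm (A *m (x - w)).
Proof.
have wE : A *m w - b = -1 *: (A *m (x - w)) + (A *m x - b).
  by rewrite mulmxBr scaleN1r opprB -!addrA addKr.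
rewrite gradient_loss /loss wE sqnorm_line dotZl (dot_mulmx A^T) trmxK.
rewrite -(opprB x w) mulmxN dotNr; ring.
Qed.

(** The gradients of the loss at [sample A j] and at 0 differ by
    [2 |A_j|^2 A_j], so [2 |A_j|^2] is at most [l] unless [A_j] vanishes. *)
Lemma smoothness_sample_loss_ge {R : realType} {s d : nat} (A : 'M[R]_(s, d))
    b j l :
  smoothness_constant (sample_loss A b j) l ->
  4 * sqnorm (sample A j) ^+ 2 <= l ^+ 2.
Proof.
case=> /(_ (sample A j) 0) + _; rewrite !gradient_sample_loss subr0.
rewrite -scalerBl /enorm sqnormZ.
set N := sqnorm (sample A j).
have -> : dot (sample A j) 0 = 0 by rewrite dotE mulmx0 mxE.
rewrite -/(sqnorm (sample A j)) -/N => hl.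
have N0 : 0 <= N by exact: sqnorm_ge0.
have [N00|Nn0] := eqVneq N 0; first by rewrite N00 expr0n mulr0 sqr_ge0.
have N_gt0 : 0 < N by rewrite lt_def Nn0.
have := hl; have -> : 2 * (N - b j 0) - 2 * (0 - b j 0) = 2 * N by ring.
rewrite sqrtrM ?sqr_ge0 // sqrtr_sqr ger0_norm; last by rewrite mulr_ge0.
rewrite ler_pM2r ?sqrtr_gt0 // => l2.
have -> : 4 * N ^+ 2 = (2 * N) ^+ 2 by ring.
by rewrite lerXn2r // nnegrE ?(le_trans _ l2) // mulr_ge0.
Qed.

(** * Variance of the PermK estimator *)

Lemma block_dotE {R : realType} {d n : nat} (blk : 'I_d -> 'I_n) i
    (u v : 'cV[R]_d) :
  block_dot blk i u v = dot (\col_c (if blk c == i then u c 0 else 0)) v.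
Proof.
rewrite /block_dot big_mkcond; apply: eq_bigr => c _.
by rewrite mxE; case: ifP; rewrite ?mul0r.
Qed.

Lemma sum_block_dot {R : realType} {d n : nat} (blk : 'I_d -> 'I_n)
    (u v : 'cV[R]_d) : \sum_i block_dot blk i u v = dot u v.
Proof. by rewrite /dot (partition_big blk xpredT). Qed.

(** Cauchy-Schwarz on each block, with [|v|] in place of the norm of the block
    of [v]; the squared norms of the blocks of [u] add up to that of [u]. *)
Lemma sum_sqr_block_dot_le {R : realType} {d n : nat} (blk : 'I_d -> 'I_n)
    (u v : 'cV[R]_d) :
  \sum_i block_dot blk i u v ^+ 2 <= sqnorm u * sqnorm v.
Proof.
rewrite /(sqnorm u) -(sum_block_dot blk) mulr_suml.
apply: ler_sum => i _; rewrite block_dotE.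
apply: le_trans (dot_CauchySchwarz _ _) _.
rewrite ler_wpM2r ?sqnorm_ge0 // /block_dot big_mkcond le_eqVlt.
apply/orP; left; apply/eqP; apply: eq_bigr => c _.
by rewrite mxE; case: ifP; rewrite ?mul0r.
Qed.

Lemma sum_mulmx_trmx {R : realType} {s d : nat} (A : 'M[R]_(s, d)) (c : 'cV_s) :
  \sum_j c j 0 *: sample A j = A^T *m c.
Proof.
apply/colP => k; rewrite summxE mxE; apply: eq_bigr => j _.
by rewrite !mxE mulrC.
Qed.

Section PermKVariance.
Context {R : realType} {s n : nat} (q : assignment s n -> R).
Hypotheses (n_gt0 : (0 < n)%N) (qP : permk_law q).

Lemma permk_indicator_mean j i : \sum_a q a * indicator R a j i = n%:R^-1.
Proof.
case: qP => _ _ /(_ j i) <-; rewrite /Pr [RHS]big_mkcond; apply: eq_bigr => a _.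
by rewrite /indicator; case: (j \in a i); rewrite ?mulr1 ?mulr0.
Qed.

(** At most one indicator is nonzero, as the sets of the workers are disjoint. *)
Lemma permk_sqr_sum (a : assignment s n) j (e : 'I_n -> R) : 0 < q a ->
  (\sum_i e i * indicator R a j i) ^+ 2 = \sum_i e i ^+ 2 * indicator R a j i.
Proof.
case: qP => _ disj _ qa; rewrite /indicator.
have [/existsP[i ji]|no] := boolP [exists i, j \in a i].
  have other t : t != i -> j \in a t = false.
    move=> ti; apply/negbTE/negP => jt; have := disj a t i qa ti.
    by move=> /pred0P/(_ j); rewrite /= jt ji.
  rewrite (bigD1 i) //= [in RHS](bigD1 i) //= ji !mulr1.
  by rewrite !big1 ?addr0 // => t /other ->; rewrite mulr0.
have none i : j \in a i = false.
  by apply: contraNF no => ji; apply/existsP; exists i.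
by rewrite !big1 ?expr0n // => i _; rewrite none mulr0.
Qed.

(** [n] times the transmitted sum is unbiased, with mean [\sum_i e i]; its second
    moment comes from [permk_sqr_sum]. *)
Lemma permk_variance j (e : 'I_n -> R) :
  \sum_a q a * (n%:R * (\sum_i e i * indicator R a j i) - \sum_i e i) ^+ 2
  = n%:R * (\sum_i e i ^+ 2) - (\sum_i e i) ^+ 2.
Proof.
have [[q0 q1] _ _] := qP; set m := \sum_i e i.
have n0 : n%:R != 0 :> R by rewrite pnatr_eq0 -lt0n.
pose f i := n%:R ^+ 2 * e i ^+ 2 - 2 * n%:R * m * e i.
transitivity (\sum_a (\sum_i f i * (q a * indicator R a j i) + q a * m ^+ 2)).
  apply: eq_bigr => a _; have := q0 a.
  rewrite le_eqVlt => /predU1P[<-|qa].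
    by rewrite !mul0r big1 ?addr0 // => i _; rewrite mul0r mulr0.
  rewrite sqrrB exprMn permk_sqr_sum // mulrDr mulrBr; congr (_ + _).
  have -> : q a * (n%:R * (\sum_i e i * indicator R a j i) * m *+ 2)
            = (q a * (2 * n%:R * m)) * \sum_i e i * indicator R a j i by ring.
  rewrite (mulrA (q a) (_ ^+ 2)) [X in X - _]mulr_sumr [X in _ - X]mulr_sumr.
  by rewrite -sumrB; apply: eq_bigr => i _; rewrite /f; ring.
rewrite big_split /= -mulr_suml q1 exchange_big /=.
under eq_bigr do rewrite -mulr_sumr permk_indicator_mean mulrBl.
rewrite sumrB -!mulr_suml -!mulr_sumr -/m; by field.
Qed.

End PermKVariance.

Section Estimator.
Context {R : realType} {s d n : nat} (A : 'M[R]_(s, d)) (b : 'cV[R]_s).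
Context (blk : 'I_d -> 'I_n) (q : assignment s n -> R).
Hypotheses (n_gt0 : (0 < n)%N) (qP : permk_law q).

Lemma estimator_error (a : assignment s n) x w :
  estimator A b blk a x w - gradient (loss A b) x
  = (2 / s%:R) *: (A^T *m \col_j
      (n%:R * (\sum_i block_dot blk i (sample A j) (x - w) * indicator R a j i)
       - \sum_i block_dot blk i (sample A j) (x - w))).
Proof.
rewrite /estimator !gradient_loss.
set c := fun j => \sum_i block_dot blk i (sample A j) (x - w) * indicator R a j i.
have -> : \sum_j c j *: sample A j = A^T *m \col_j c j.
  by rewrite -sum_mulmx_trmx; apply: eq_bigr => j _; rewrite mxE.
rewrite -addrA -scalerBr -mulmxBr (mulrAC 2 n%:R) -(scalerA _ n%:R).
rewrite -scalerDr scalemxAr -mulmxDr.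
congr (_ *: (_ *m _)); apply/colP => j.
rewrite [RHS]mxE sum_block_dot -mulmx_sample mulmxBr !mxE /c; ring.
Qed.

(** [sqnorm_trmx_mulmx_le] removes [A^T] from the error at the cost of the factor
    [L]; what remains is the sum over the samples of the variances of
    [permk_variance]. *)
Lemma permk_error_le (L : R) : 0 <= L ->
  (forall u, sqnorm (A *m u) <= L * sqnorm u) ->
  forall x w,
  \sum_a q a * sqnorm (estimator A b blk a x w - gradient (loss A b) x)
  <= (2 / s%:R) ^+ 2 * L * (n%:R * sqfrobenius A * sqnorm (x - w)).
Proof.
move=> L0 AL x w; have [[q0 _] _ _] := qP.
set e := fun j i => block_dot blk i (sample A j) (x - w).
set v := fun a : assignment s n =>
  \col_j (n%:R * (\sum_i e j i * indicator R a j i) - \sum_i e j i).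
apply: (@le_trans _ _ (\sum_a q a * ((2 / s%:R) ^+ 2 * L * sqnorm (v a)))).
  apply: ler_sum => a _; rewrite ler_wpM2l // estimator_error sqnormZ -mulrA.
  by rewrite ler_wpM2l ?sqr_ge0 // sqnorm_trmx_mulmx_le.
under eq_bigr do rewrite mulrCA.
rewrite -mulr_sumr ler_wpM2l ?mulr_ge0 ?sqr_ge0 //.
under eq_bigr do rewrite mulr_sumr.
rewrite exchange_big /= -mulrA [leRHS]mulrC mulr_suml mulr_suml.
apply: ler_sum => j _.
under eq_bigr do rewrite -expr2 mxE.
rewrite permk_variance // mulrC.
apply: le_trans (_ : n%:R * (\sum_i e j i ^+ 2) <= _).
  by rewrite gerBl sqr_ge0.
by rewrite ler_wpM2l // sum_sqr_block_dot_le.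
Qed.

End Estimator.

(** * Conditioning on the iterates, and the least constant *)

Lemma block_partition_le {d n : nat} (blk : 'I_d -> 'I_n) :
  is_block_partition blk -> (n <= d)%N.
Proof.
move=> /choice[g gK]; rewrite -[n]card_ord -[d]card_ord.
exact: leq_card (can_inj gK).
Qed.

(** If [X] on the event depends only on the second of two independent variables,
    and the event only on the first, then conditioning on the event leaves the
    law of the second unchanged. *)
Lemma cond_expectation_prod {R : realType} {H T : finType}
    (Q : H -> R) (q : T -> R) (E : pred H) (g : T -> R) (X : H * T -> R) :
  \sum_t q t = 1 -> (forall h t, E h -> X (h, t) = g t) ->
  Pr (fun z : H * T => Q z.1 * q z.2) (fun z => E z.1) != 0 ->
  cond_expectation (fun z : H * T => Q z.1 * q z.2) (fun z => E z.1) X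
  = \sum_t q t * g t.
Proof.
move=> q1 Xg; rewrite /cond_expectation.
have sum_prod (G : H -> T -> R) :
    \sum_(z | E z.1) G z.1 z.2 = \sum_(h | E h) \sum_t G h t.
  by rewrite pair_big; apply: eq_bigl => z; rewrite andbT.
have -> : Pr (fun z : H * T => Q z.1 * q z.2) (fun z => E z.1)
          = \sum_(h | E h) Q h.
  rewrite /Pr (sum_prod (fun h t => Q h * q t)).
  by apply: eq_bigr => h _; rewrite -mulr_sumr q1 mulr1.
move=> Q0; apply: (canLR (mulfK Q0)).
rewrite (eq_bigr (fun z : H * T => Q z.1 * q z.2 * X (z.1, z.2))); last by case.
rewrite (sum_prod (fun h t => Q h * q t * X (h, t))).
rewrite mulrC mulr_suml; apply: eq_bigr => h Eh.
by rewrite mulr_sumr; apply: eq_bigr => t _; rewrite Xg // mulrA.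
Qed.

(** The assignment of round [k] is independent of the history that determines
    [x^k] and [w^k]. *)
Lemma cond_sq_errorE {R : realType} {s d n : nat} (A : 'M[R]_(s, d)) b
    (blk : 'I_d -> 'I_n) (q : assignment s n -> R) p prm x0 k x w :
  is_pmf q -> 0 < Pr (@iteration_law R s n q p k) (at_point A b blk prm x0 x w) ->
  cond_expectation (@iteration_law R s n q p k) (at_point A b blk prm x0 x w)
    (@sq_error R s d n A b blk prm x0 k)
  = \sum_a q a * sqnorm (estimator A b blk a x w - gradient (loss A b) x).
Proof.
move=> [_ q1] Prgt0.
pose E (h : k.-tuple (round s n)) :=
  (x_of prm (run A b blk prm x0 h) == x) && (w_of (run A b blk prm x0 h) == w).
pose g a := sqnorm (estimator A b blk a x w - gradient (loss A b) x).
apply: (@cond_expectation_prod R (k.-tuple (round s n)) (assignment s n)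
          (fun h => history_law q p h) q E g) => //.
  by move=> h a /andP[/eqP hx /eqP hw]; rewrite /sq_error /= hx hw.
by rewrite gt_eqF.
Qed.

(** The constraints are closed half-lines: each passes to the infimum, because it
    can be divided by [c i] unless [c i = 0], in which case it does not mention
    [l]. *)
Lemma least_coefficient {R : realType} {I : Type} (P : I -> Prop)
    (e c : I -> R) (l0 : R) :
  0 <= l0 -> (forall i, P i -> 0 <= c i) ->
  (forall i, P i -> e i <= 2 * l0 * c i) ->
  exists2 m, is_least
    [set l | 0 <= l /\ forall i, P i -> e i <= 2 * l * c i] m & m <= l0.
Proof.
move=> l0_ge0 c0 el0; set S := [set _ | _].
have Sl0 : S l0 by [].
have S_lb : lbound S 0 by move=> l [].
exists (inf S); last by apply: ge_inf => //; exists 0.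
split; last by move=> l Sl; apply: ge_inf => //; exists 0.
split=> [|i Pi]; first by apply: lb_le_inf; first exists l0.
have [ci|ci] := eqVneq (c i) 0; first by have := el0 i Pi; rewrite ci !mulr0.
have ci_gt0 : 0 < c i by rewrite lt_def ci c0.
rewrite mulrAC mulrC -ler_pdivrMr ?mulr_gt0 //.
apply: lb_le_inf; first by exists l0.
by move=> l [_ /(_ i Pi)]; rewrite ler_pdivrMr ?mulr_gt0 // mulrCA mulrA.
Qed.

(** * The bound on the efficient Lipschitz constant *)

Theorem lemma8 (R : realType) (s d n : nat) (n_gt0 : (0 < n)%N)
    (A : 'M[R]_(s, d)) (b : 'cV[R]_s) (mu L : R)
    (mu_gt0 : 0 < mu) (mu_le_L : mu <= L)
    (spectrum : forall a : R, eigenvalue (A^T *m A) a -> mu <= a <= L)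
    (blk : 'I_d -> 'I_n) (blkP : is_block_partition blk)
    (Ls : 'I_s -> R)
    (LsP : forall j, smoothness_constant (sample_loss A b j) (Ls j))
    (q : assignment s n -> R) (qP : permk_law q)
    (p : R) (p_gt0 : 0 < p) (p_le1 : p <= 1)
    (prm : parameters R) (Lambda_gt0 : 0 < Lambda prm) (x0 : 'cV[R]_d) :
  exists Lt : R,
    is_efficient_lipschitz A b blk q p prm x0 Lt /\
    Lt < 2 * L * ((s%:R * \sum_(j < s) Ls j ^+ 2) / mu ^+ 2).
Proof.
have L_gt0 : 0 < L by exact: lt_le_trans mu_le_L.
have [pmf_q _ _] := qP.
have Amu : forall u, mu * sqnorm u <= sqnorm (A *m u).
  by apply: sqnorm_mulmx_ge_eigenvalue => a /spectrum /andP[].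
have AL : forall u, sqnorm (A *m u) <= L * sqnorm u.
  by apply: sqnorm_mulmx_le_eigenvalue => a /spectrum /andP[].
set F := sqfrobenius A.
have nR_gt0 : 0 < n%:R :> R by rewrite ltr0n.
have Fn : n%:R * mu <= F.
  apply: le_trans (sqfrobenius_ge Amu); rewrite ler_pM2r // ler_nat.
  exact: block_partition_le blkP.
have F_gt0 : 0 < F by apply: lt_le_trans Fn; rewrite mulr_gt0.
(* A matrix without rows has [F = 0]. *)
have s_gt0 : (0 < s)%N.
  rewrite lt0n; apply: contraTneq F_gt0 => s0.
  rewrite /F /sqfrobenius big1 ?ltxx // => j _.
  by move: (ltn_ord j); rewrite {2}s0 ltn0.
have sR_ge1 : 1 <= s%:R :> R by rewrite ler1n.
have sR_gt0 : 0 < s%:R :> R by rewrite ltr0n.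
pose l0 := 2 * L * n%:R * F / (s%:R * mu).
have l0_ge0 : 0 <= l0 by rewrite divr_ge0 ?mulr_ge0 // ltW.
pose P (i : nat * ('cV[R]_d * 'cV[R]_d)) :=
  0 < Pr (@iteration_law R s n q p i.1) (at_point A b blk prm x0 i.2.1 i.2.2).
pose e (i : nat * ('cV[R]_d * 'cV[R]_d)) :=
  cond_expectation (@iteration_law R s n q p i.1)
    (at_point A b blk prm x0 i.2.1 i.2.2) (@sq_error R s d n A b blk prm x0 i.1).
pose c (i : nat * ('cV[R]_d * 'cV[R]_d)) :=
  loss A b i.2.2 - loss A b i.2.1
  - dot (gradient (loss A b) i.2.1) (i.2.2 - i.2.1).
have [|i Pi|m [[m_ge0 mP] m_least] m_le] := @least_coefficient R _ P e c l0 l0_ge0.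
- by move=> i _; rewrite /c loss_Bregman mulr_ge0 ?sqnorm_ge0 ?invr_ge0 ?ltW.
- rewrite /e cond_sq_errorE // /c loss_Bregman.
  apply: le_trans (permk_error_le b blk n_gt0 qP (ltW L_gt0) AL _ _) _.
  set u := _ - _; rewrite -/F.
  (* [l0] is chosen to make this an identity. *)
  have -> : (2 / s%:R) ^+ 2 * L * (n%:R * F * sqnorm u)
            = 2 * l0 / s%:R * (mu * sqnorm u).
    by rewrite /l0; field; rewrite !gt_eqF.
  by rewrite [leRHS]mulrA ler_wpM2l ?Amu // divr_ge0 // ?ler0n // mulr_ge0.
exists m; split.
  split; first by split=> // k x w Pk; exact: (mP (k, (x, w)) Pk).
  by move=> l [l_ge0 lP]; apply: m_least; split=> // -[k [x w]] /lP.
apply: le_lt_trans m_le _.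
(* Cauchy-Schwarz over the samples, then [2 |A_j|^2 <= |Ls j|]. *)
have LsF : 4 * F ^+ 2 <= s%:R * \sum_j Ls j ^+ 2.
  apply: (@le_trans _ _ (s%:R * \sum_j (4 * sqnorm (sample A j) ^+ 2))).
    by rewrite -mulr_sumr [leRHS]mulrCA ler_wpM2l ?sum_sqr_le.
  rewrite ler_wpM2l ?ler0n //; apply: ler_sum => j _.
  exact: smoothness_sample_loss_ge (LsP j).
apply: (@lt_le_trans _ _ (2 * L * (4 * F ^+ 2 / mu ^+ 2))); last first.
  rewrite ler_pM2l; last by rewrite mulr_gt0.
  by rewrite ler_pM2r // invr_gt0 exprn_gt0.
apply: (@le_lt_trans _ _ (2 * L * (n%:R * F / mu))).
  rewrite /l0 -!mulrA ler_pM2l // ler_pM2l // ler_pM2l // ler_pM2l //.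
  by rewrite invfM ler_piMl ?invr_ge0 ?(ltW mu_gt0) // invf_le1.
rewrite ltr_pM2l ?mulr_gt0 //.
(* What remains is [n mu F < 4 F^2], by [Fn]; the factor 4 and the positivity of
   [F] make the bound strict. *)
have -> : n%:R * F / mu = n%:R * mu * F / mu ^+ 2 by field; rewrite gt_eqF.
rewrite ltr_pM2r ?invr_gt0 ?exprn_gt0 //; nra.
Qed.
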